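(* Consider the multiscale P-IMPES saturation update described in the context. Assume that $S_\alpha^{H,n}\in(0,1)$ and that there exists a tolerance saturation $S_{t\alpha}>0$ such that $$S_\alpha^{H,n}\ge S_{t\alpha}>0,\qquad \alpha=w,n.$$ Let $\Delta t=t_{n+1}-t_n$. If $\frac{\Delta t}{h}$ is sufficiently small (i.e. below some positive threshold), then on every fine cell $K^h\in\mathcal T_h$ $$S_\alpha^{H,n+1}\in(0,1),\qquad \alpha=w,n.$$
   Context: $\Omega\subset\mathbb R^2$ is partitioned by a fine mesh $\mathcal T_h$ of mesh size $h$ with cells $K^h$. $V_h$ is the lowest-order Raviart--Thomas space on $\mathcal T_h$, $Q_h$ the piecewise constants, $(\cdot,\cdot)$ the $L^2(\Omega)$ inner product. $\phi\in(0,1)$ is the constant porosity; $\lambda_\alpha=k_{r\alpha}/\mu_\alpha$ ($\alpha=w,n$, wetting and non-wetting) are phase mobilities, $\lambda_t=\lambda_w+\lambda_n$, $f_\alpha=\lambda_\alpha/\lambda_t$ the fractional flow functions. $F_\alpha$ are source/sink terms, $F_t=F_w+F_n$. Known structural facts of the model: there are constants $l_\alpha>0$ with $f_\alpha\le l_\alpha S_\alpha$ (where $f_\alpha$ is viewed as a function of $S_\alpha$); and where $F_\alpha$ is a sink term ($F_\alpha\le0$) there are constants $l_1,l_2>0$ with $l_1S_\alpha\le|F_\alpha|\le l_2S_\alpha$. Numerical fluxes: for $\mathbf v\in V_h$, $q\in Q_h$, $$\beta_\alpha(\mathbf v,q;S_w)=\sum_{K^h}\int_{\partial K^h}f_\alpha(S^{*}_{w,\alpha})\,\mathbf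 v\cdot\mathbf n\,q,\qquad \beta_c(\mathbf v,q;S_w)=\sum_{K^h}\int_{\partial K^h}f_n(S^{*}_{w,n})f_w(S^{*}_{w,w})\,\mathbf v\cdot\mathbf n\,q,$$ where $\mathbf n$ is the outward normal of $K^h$ and, on an edge $e$ between $K^h$ and a neighbour $K^{h,1}$, $S_\alpha^*|_e=S_\alpha|_{K^h}$ if the phase flux $\{\mathbf u_\alpha\cdot\mathbf n\}_e\ge0$ and $S_\alpha^*|_e=S_\alpha|_{K^{h,1}}$ otherwise; $S^*_{w,w}=S^*_w$, $S^*_{w,n}=1-S^*_n$; on inflow boundary edges $S^*_{w,\alpha}|_e=S_w|_{K^h}$. From the piecewise constant saturation $S_w^{H,n}$ (with $S_n^{H,n}=1-S_w^{H,n}$) the scheme computes, independently of $\Delta t$, a capillary velocity $\xi_c^{H,n+1}\in V_h$ and a (postprocessed multiscale) total velocity $\mathbf u_t^{H,n+1}\in V_h$ satisfying $\beta_w(\mathbf u_t^{H,n+1},q;S_w^{H,n})+\beta_n(\mathbf u_t^{H,n+1},q;S_w^{H,n})=(F_t,q)$ for all $q\in Q_h$. The new saturations $S_w^{H,n+1},S_n^{H,n+1}\in Q_h$ are then defined by $$\left(\phi\frac{S_w^{H,n+1}-S_w^{H,n}}{\Delta t},\mathbf 1_{K^h}\right)=-\beta_w(\mathbf u_t^{H,n+1},\mathbf 1_{K^h};S_w^{H,n})+\beta_c(\xi_c^{H,n+1},\mathbf 1_{K^h};S_w^{H,n})+(F_w,\mathbf 1_{K^h})\quad\forall K^h\in\mathcal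 T_h,$$ $$S_n^{H,n+1}=1-S_w^{H,n+1}.$$ The threshold for $\Delta t/h$ may depend on the data at time level $n$ (mesh, velocities, source terms, $l_\alpha,l_1,l_2$, $S_{t\alpha}$, $\phi$). *)

(* Defs.v *)
From HB Require Import structures.
From mathcomp Require Import all_boot all_order all_algebra.
From mathcomp Require Import all_classical all_reals all_analysis.
Import Order.TTheory GRing.Theory Num.Theory.
Import numFieldNormedType.Exports.
Set Implicit Arguments.
Unset Strict Implicit.
Unset Printing Implicit Defensive.
Local Open Scope classical_set_scope.
Local Open Scope ring_scope.

Definition pt (R : realType) := (R * R)%type.

Section Plane.
Variable R : realType.
Implicit Types (p q x : pt R) (t : R).

Definition pscale t p : pt R := (t * p.1, t * p.2).
Definition dot p q : R := p.1 * q.1 + p.2 * q.2.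
Definition cross p q : R := p.1 * q.2 - p.2 * q.1.
Definition enorm p : R := Num.sqrt (dot p p).
Definition diam (A : set (pt R)) : R :=
  sup [set d | exists x y, [/\ A x, A y & d = enorm (x - y)]].

Definition area := (@lebesgue_measure R \x @lebesgue_measure R)%E.

Definition edge := (pt R * pt R)%type.
Definition rev_edge (e : edge) : edge := (e.2, e.1).
Definition edge_pt (e : edge) t : pt R := pscale (1 - t) e.1 + pscale t e.2.
Definition segment (e : edge) : set (pt R) := edge_pt e @` `[0, 1].
Definition edge_len (e : edge) : R := enorm (e.2 - e.1).

(* Unit normal to the right of [e]: it is the outward normal when [e] is an
   edge of a polygon whose boundary is run through counterclockwise. *)
Definition normal (e : edge) : pt R :=
  pscale (edge_len e)^-1 ((e.2 - e.1).2, - (e.2 - e.1).1).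

Definition edge_int (e : edge) (g : pt R -> R) : R :=
  edge_len e * Rintegral (@lebesgue_measure R) `[0, 1] (fun t => g (edge_pt e t)).

(* [Tri a b c] has vertices a, b, c; [Para p a b] is the parallelogram with
   vertices p, p + a, p + a + b, p + b (rectangles being a special case). *)
Inductive cell := Tri of pt R & pt R & pt R | Para of pt R & pt R & pt R.

(* Positive orientation: the vertex lists below are counterclockwise. *)
Definition nondegenerate (c : cell) : Prop :=
  match c with
  | Tri a b c => 0 < cross (b - a) (c - a)
  | Para _ a b => 0 < cross a b
  end.

Definition vertices (c : cell) : seq (pt R) :=
  match c with
  | Tri a b c => [:: a; b; c]
  | Para p a b => [:: p; p + a; p + a + b; p + b]
  end.

Definition edges (c : cell) : seq edge :=
  zip (vertices c) (rot 1 (vertices c)).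

Definition closed_cell (c : cell) : set (pt R) :=
  [set x | forall e, e \in edges c -> 0 <= cross (e.2 - e.1) (x - e.1)].
Definition open_cell (c : cell) : set (pt R) :=
  [set x | forall e, e \in edges c -> 0 < cross (e.2 - e.1) (x - e.1)].

(* Lowest-order local space: a + b x on a triangle; on a parallelogram, the
   Piola image of P_{1,0} x P_{0,1}, which for an axis-parallel rectangle is
   the usual (a0 + a1 x_1, b0 + b1 x_2). *)
Definition RT0 (c : cell) (v : pt R -> pt R) : Prop :=
  match c with
  | Tri _ _ _ => exists (a : pt R) (b : R), forall x, v x = a + pscale b x
  | Para p a b => exists a0 a1 b0 b1 : R, forall s t : R,
      v (p + pscale s a + pscale t b)
      = pscale (a0 + a1 * s) a + pscale (b0 + b1 * t) b
  end.

End Plane.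

Record mesh (R : realType) := Mesh {
  cells :> finType;
  geo : cells -> cell R;
  geo_nondegenerate : forall K, nondegenerate (geo K);
  geo_conforming : forall K K' : cells, K != K' ->
    let I := closed_cell (geo K) `&` closed_cell (geo K') in
    [\/ I = set0,
        exists v, [/\ v \in vertices (geo K), v \in vertices (geo K')
                    & I = [set v]]
      | exists e, [/\ e \in edges (geo K), rev_edge e \in edges (geo K')
                    & I = segment e]]
}.

Section Discrete.
Variables (R : realType) (M : mesh R).

Definition Omega : set (pt R) := (\bigcup_(K : M) closed_cell (geo K))°.

Definition mesh_size : R := \big[Num.max/0]_(K : M) diam (closed_cell (geo K)).

(* The cell on the other side of the edge [e] of a cell; [None] when [e] lies
   on the boundary of [Omega]. *)
Definition neighbour (e : edge R) : option M :=
  [pick K' : M | rev_edge e \in edges (geo K')].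

(* A piecewise constant function is given by its values on the cells;
   [Qh_fun] is the function on the plane, set to 0 on the null set of edges. *)
Definition Qh := M -> R.
Definition Qh_fun (q : Qh) (x : pt R) : R :=
  \sum_(K : M) q K * \1_(open_cell (geo K)) x.
Definition one_cell (K : M) : Qh := fun K' => (K' == K)%:R.

Definition inner (f g : pt R -> R) : R :=
  Rintegral (@area R) Omega (fun x => f x * g x).

Definition L2 (f : pt R -> R) : Prop :=
  measurable_fun Omega f /\
  (@area R).-integrable Omega (fun x => (f x ^+ 2)%:E).

(* A piecewise polynomial vector field is the family of its restrictions to
   the cells, so that it has a trace from each side of an edge. *)
Definition field := M -> pt R -> pt R.
Definition broken_RT0 (v : field) : Prop := forall K, RT0 (geo K) (v K).
Definition Vh (v : field) : Prop :=
  broken_RT0 v /\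
  forall (K K' : M) e, e \in edges (geo K) -> rev_edge e \in edges (geo K') ->
    forall x, segment e x -> dot (v K x) (normal e) = dot (v K' x) (normal e).

(* Integral over [e] of the average {u . n}, n being the outward normal of the
   cell [K] having [e] as an edge; on a boundary edge, the one-sided flux. For
   u in RT0 the integrand is constant on [e]. *)
Definition edge_flux (u : field) (K : M) (e : edge R) : R :=
  edge_int e (fun x =>
    if neighbour e is Some K'
    then (dot (u K x) (normal e) + dot (u K' x) (normal e)) / 2
    else dot (u K x) (normal e)).

End Discrete.

Inductive phase := wetting | nonwetting.

Section Flow.
Variables (R : realType) (kr : phase -> R -> R) (visc : phase -> R).

(* Mobilities and fractional flows are functions of the wetting saturation. *)
Definition mobility (a : phase) (s : R) : R := kr a s / visc a.
Definition total_mobility (s : R) : R :=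
  mobility wetting s + mobility nonwetting s.
Definition frac (a : phase) (s : R) : R := mobility a s / total_mobility s.

(* S_a as a function of S_w; being an involution, it also gives S_w as a
   function of S_a. *)
Definition sat_of (a : phase) (s : R) : R :=
  if a is wetting then s else 1 - s.

Variable M : mesh R.

Definition sat (a : phase) (Sw : Qh M) : Qh M := fun K => sat_of a (Sw K).

Variable u : phase -> field M.

Definition upwind (a : phase) (Sw : Qh M) (K : M) (e : edge R) : R :=
  if 0 <= edge_flux (u a) K e then sat a Sw K
  else if neighbour M e is Some K' then sat a Sw K' else sat a Sw K.

(* S^*_{w,w} = S^*_w and S^*_{w,n} = 1 - S^*_n. *)
Definition upwind_w (a : phase) (Sw : Qh M) (K : M) (e : edge R) : R :=
  sat_of a (upwind a Sw K e).

Definition beta (a : phase) (v : field M) (q : Qh M) (Sw : Qh M) : R :=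
  \sum_(K : M) \sum_(e <- edges (geo K))
    edge_int e (fun x =>
      frac a (upwind_w a Sw K e) * dot (v K x) (normal e) * q K).

Definition beta_c (v : field M) (q : Qh M) (Sw : Qh M) : R :=
  \sum_(K : M) \sum_(e <- edges (geo K))
    edge_int e (fun x =>
      frac nonwetting (upwind_w nonwetting Sw K e)
      * frac wetting (upwind_w wetting Sw K e)
      * dot (v K x) (normal e) * q K).

Variable F : phase -> pt R -> R.

Definition total_source (x : pt R) : R := F wetting x + F nonwetting x.

Definition total_mass_conservation (ut : field M) (Sw : Qh M) : Prop :=
  forall q : Qh M,
    beta wetting ut q Sw + beta nonwetting ut q Sw
    = inner M total_source (Qh_fun q).

Definition saturation_update (phi dt : R) (ut xic : field M)
    (Sw Sw' : Qh M) : Prop :=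
  forall K : M,
    inner M (fun x => phi * ((Qh_fun Sw' x - Qh_fun Sw x) / dt))
      (Qh_fun (one_cell K))
    = - beta wetting ut (one_cell K) Sw + beta_c xic (one_cell K) Sw
      + inner M (F wetting) (Qh_fun (one_cell K)).

(* f_a <= l_a S_a, with f_a viewed as a function of s = S_a. *)
Definition frac_bound (l : phase -> R) : Prop :=
  forall a (s : R), 0 <= s <= 1 -> frac a (sat_of a s) <= l a * s.

(* Sinks are the points where F_a < 0: for S_a > 0 the lower bound cannot hold
   where F_a vanishes, i.e. where there is neither a source nor a sink. *)
Definition sink_bound (l1 l2 : R) (Sw : Qh M) : Prop :=
  forall a (K : M),
    {ae @area R, forall x, open_cell (geo K) x -> F a x < 0 ->
       l1 * sat a Sw K <= `|F a x| <= l2 * sat a Sw K}.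

End Flow.

(* Main.v *)
Require Import Defs.
From HB Require Import structures.
From mathcomp Require Import all_boot all_order all_algebra.
From mathcomp Require Import all_classical all_reals all_analysis.
From mathcomp Require Import measurable_realfun.
From mathcomp Require Import ring lra.
Import Order.TTheory GRing.Theory Num.Theory.
Import numFieldNormedType.Exports.
Local Open Scope classical_set_scope.
Local Open Scope ring_scope.

Set Implicit Arguments.
Unset Strict Implicit.
Unset Printing Implicit Defensive.

(** The saturation increment on a cell [K] is [dt / (phi * area K)] times the
    net flux through the boundary of [K] plus the source term. The fluxes are
    bounded independently of the saturations: as the fractional flows add up to
    1 and each is bounded above by [l a] on [[0, 1]], each is bounded in
    absolute value ([normr_frac_le]), and the upwind saturations are
    saturations of cells, hence lie in [[0, 1]] ([upwind_w_01]). The remaining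
    factors are edge fluxes of the given velocities, which depend only on the
    data ([normr_beta_le], [normr_beta_c_le]). Hence the increment is at most
    [dt * C], with [C] a constant of the data, and as soon as [dt * C] is below
    both tolerances [St a], neither phase can be exhausted; the upper bound 1
    for one phase is the lower bound 0 for the other.

    Two geometric facts turn this into a proof. The equation tested with the
    indicator of [K] determines the increment because the open cells are
    disjoint and have positive finite area ([inner_one_cell],
    [area_open_cell_gt0], [area_open_cell_lty]). A smallness condition on
    [dt / h] is one on [dt] because the mesh size [h] is fixed by the mesh and
    positive ([mesh_size_gt0]), cells being bounded and having two distinct
    points.

    The edge integrals are explicit because the normal component of a
    lowest-order Raviart--Thomas field is constant on each edge
    ([RT0_normal_trace_cst]). *)

(** * Cells have positive finite area and positive diameter *)

Section CellGeometry.
Context {R : realType}.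
Implicit Types (c : cell R) (x y : pt R) (s : seq (edge R)).

Lemma closed_cell_tri (a b d x : pt R) :
  closed_cell (Tri a b d) x <->
  [/\ 0 <= cross (b - a) (x - a), 0 <= cross (d - b) (x - b)
    & 0 <= cross (a - d) (x - d)].
Proof.
split=> [h|[h1 h2 h3] e].
- by split; [apply: (h (a, b))|apply: (h (b, d))|apply: (h (d, a))];
    rewrite /edges /= !inE eqxx ?orbT.
- by rewrite /edges /= !inE => /or3P[] /eqP ->.
Qed.

Lemma closed_cell_para (p a b x : pt R) :
  closed_cell (Para p a b) x <->
  [/\ 0 <= cross a (x - p), 0 <= cross b (x - (p + a)),
      0 <= cross a ((p + a + b) - x) & 0 <= cross b (p + b - x)].
Proof.
have E0 : cross (p + a - p) (x - p) = cross a (x - p).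
  by rewrite /cross /=; ring.
have E1 : cross (p + a + b - (p + a)) (x - (p + a)) = cross b (x - (p + a)).
  by rewrite /cross /=; ring.
have E2 : cross (p + b - (p + a + b)) (x - (p + a + b))
    = cross a ((p + a + b) - x).
  by rewrite /cross /=; ring.
have E3 : cross (p - (p + b)) (x - (p + b)) = cross b (p + b - x).
  by rewrite /cross /=; ring.
split=> [h|[h1 h2 h3 h4] e].
- rewrite -E0 -E1 -E2 -E3.
  by split; [apply: (h (p, p + a))|apply: (h (p + a, p + a + b))
    |apply: (h (p + a + b, p + b))|apply: (h (p + b, p))];
    rewrite /edges /= !inE eqxx ?orbT.
- by rewrite /edges /= !inE => /or4P[] /eqP -> /=; rewrite ?E0 ?E1 ?E2 ?E3.
Qed.

(** The weights [ti / D] only have to lie in the unit interval. On a triangle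
    they will be barycentric coordinates, adding up to 1; on a parallelogram
    the base vertex has weight 1 and the two side vectors have independent
    weights. *)
Lemma normr_weighted_sum3 (D t1 t2 t3 x1 x2 x3 x : R) : 0 < D ->
  0 <= t1 <= D -> 0 <= t2 <= D -> 0 <= t3 <= D ->
  D * x = t1 * x1 + t2 * x2 + t3 * x3 ->
  `|x| <= `|x1| + `|x2| + `|x3|.
Proof.
move=> D0 h1 h2 h3 e; rewrite -(ler_pM2l D0) -{1}(gtr0_norm D0) -normrM e.
have bnd t z : 0 <= t <= D -> `|t * z| <= D * `|z|.
  by case/andP=> t0 tD; rewrite normrM (ger0_norm t0) ler_wpM2r.
rewrite !mulrDr (le_trans (ler_normD _ _))// lerD ?bnd//.
by rewrite (le_trans (ler_normD _ _))// lerD ?bnd.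
Qed.

(** The signed areas that define the cell, divided by the total one, are
    barycentric coordinates on a triangle and the coordinates along the two
    sides on a parallelogram; they lie in the unit interval. *)
Lemma closed_cell_bounded c : Defs.nondegenerate c ->
  exists r : R, forall x, closed_cell c x -> `|x.1| <= r /\ `|x.2| <= r.
Proof.
case: c => [[a1 a2] [b1 b2] [d1 d2]|[p1 p2] [a1 a2] [b1 b2]] /= D0.
- exists (Num.max (`|a1| + `|b1| + `|d1|) (`|a2| + `|b2| + `|d2|)).
  move=> [x y] /closed_cell_tri[]; rewrite /cross /= in D0 * => h1 h2 h3.
  set D := (X in 0 < X) in D0.
  (* barycentric coordinates, scaled by twice the area of the triangle *)
  pose ta := (d1 - b1) * (y - b2) - (d2 - b2) * (x - b1).
  pose tb := (a1 - d1) * (y - d2) - (a2 - d2) * (x - d1).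
  pose td := (b1 - a1) * (y - a2) - (b2 - a2) * (x - a1).
  have e : ta + tb + td = D by rewrite /ta /tb /td /D; ring.
  have ha : 0 <= ta <= D by rewrite -e; apply/andP; split; rewrite /ta /tb /td; lra.
  have hb : 0 <= tb <= D by rewrite -e; apply/andP; split; rewrite /ta /tb /td; lra.
  have hd : 0 <= td <= D by rewrite -e; apply/andP; split; rewrite /ta /tb /td; lra.
  rewrite !le_max; split=> /=; apply/orP; [left|right];
    apply: (normr_weighted_sum3 D0 ha hb hd); rewrite /ta /tb /td /D; ring.
- exists (Num.max (`|p1| + `|a1| + `|b1|) (`|p2| + `|a2| + `|b2|)).
  move=> [x y] /closed_cell_para[]; rewrite /cross /= in D0 * => h1 h2 h3 h4.
  set D := (X in 0 < X) in D0.
  (* coordinates along the sides a and b, scaled by the area *)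
  pose t1 := a1 * (y - p2) - a2 * (x - p1).
  pose t2 := b2 * (x - p1) - b1 * (y - p2).
  have hp : 0 <= D <= D by rewrite ltW/=.
  have ha : 0 <= t2 <= D by apply/andP; split; rewrite /t2 /D; lra.
  have hb : 0 <= t1 <= D by apply/andP; split; rewrite /t1 /D; lra.
  rewrite !le_max; split=> /=; apply/orP; [left|right];
    apply: (normr_weighted_sum3 D0 hp ha hb); rewrite /t1 /t2 /D; ring.
Qed.

Lemma open_cell_subset_closed c : open_cell c `<=` closed_cell c.
Proof. by move=> x h e /h /ltW. Qed.

Lemma open_cell_nonempty c : Defs.nondegenerate c -> open_cell c !=set0.
Proof.
case: c => [[a1 a2] [b1 b2] [d1 d2]|[p1 p2] [a1 a2] [b1 b2]];
  rewrite /= /cross /= => D0.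
(* the barycentre *)
- exists (3^-1 * (a1 + b1 + d1), 3^-1 * (a2 + b2 + d2)) => e.
  by rewrite /edges /= !inE => /or3P[] /eqP ->; rewrite /cross /=; lra.
(* the centre of symmetry *)
- exists (p1 + 2^-1 * (a1 + b1), p2 + 2^-1 * (a2 + b2)) => e.
  by rewrite /edges /= !inE => /or4P[] /eqP ->; rewrite /cross /=; lra.
Qed.

Lemma continuous_cross (d y : pt R) :
  continuous (fun x : pt R => cross d (x - y)).
Proof.
move=> x; rewrite /cross /=.
by apply: cvgB; apply: cvgM; (try exact: cvg_cst);
   apply: cvgB; (try exact: cvg_cst); [exact: cvg_snd|exact: cvg_fst].
Qed.

Lemma measurable_cross (d y : pt R) :
  measurable_fun setT (fun x : pt R => cross d (x - y)).
Proof.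
rewrite /cross /=.
by apply: measurable_funB; apply: measurable_funM; (try exact: measurable_cst);
   apply: measurable_funB; (try exact: measurable_cst).
Qed.

Lemma open_cellE c :
  open_cell c = \bigcap_(e in [set` edges c])
    (fun x => cross (e.2 - e.1) (x - e.1)) @^-1` `]0, +oo[.
Proof.
by rewrite eqEsubset; split=> x h e /h /=; rewrite in_itv /= andbT.
Qed.

Lemma open_open_cell c : open (open_cell c).
Proof.
rewrite open_cellE bigcap_seq.
elim/big_ind: _ => [|A B oA oB|e _]; first exact: openT.
  exact: openI.
by apply: open_comp => [x _|]; [exact: continuous_cross|exact: interval_open].
Qed.

Lemma measurable_open_cell c : measurable (open_cell c).
Proof.
rewrite open_cellE; apply: fin_bigcap_measurable => [|e _].
  exact: finite_seq.
by rewrite -[X in measurable X]setTI; apply: measurable_cross.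
Qed.

Lemma area_setX (A B : set (measurableTypeR R)) :
  measurable A -> measurable B ->
  area (A `*` B) = (lebesgue_measure A * lebesgue_measure B)%E.
Proof. exact: product_measure1E. Qed.

Lemma area_open_cell_gt0 c : Defs.nondegenerate c ->
  (0 < area (open_cell c))%E.
Proof.
move=> /open_cell_nonempty [x xc].
have : nbhs x (open_cell c) by apply: open_nbhs_nbhs; split=> //; exact: open_open_cell.
move=> /nbhs_ballP[e /= e0 sub].
have mB (z : R) : measurable (ball z e : set (measurableTypeR R)).
  exact: measurable_ball.
apply: (@lt_le_trans _ _ (area (ball x.1 e `*` ball x.2 e))).
  rewrite area_setX// !lebesgue_measure_ball ?ltW//.
  by rewrite -EFinM lte_fin mulr_gt0// mulrn_wgt0.
apply: le_measure; rewrite ?inE; first exact: measurableX.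
  exact: measurable_open_cell.
by move=> y; exact: sub.
Qed.

Lemma area_open_cell_lty c : Defs.nondegenerate c ->
  (area (open_cell c) < +oo)%E.
Proof.
move=> /closed_cell_bounded [r rb].
have mI : measurable (`[- r, r]%classic : set (measurableTypeR R)).
  exact: measurable_itv.
apply: (@le_lt_trans _ _ (area (`[- r, r]%classic `*` `[- r, r]%classic))).
  apply: le_measure; rewrite ?inE; first exact: measurable_open_cell.
    exact: measurableX.
  move=> x /open_cell_subset_closed /rb [h1 h2].
  by split; rewrite /= in_itv /= -ler_norml.
by rewrite area_setX// lebesgue_measure_itv/=; case: ifP => _;
  rewrite ?mule0 ?ltry// -EFinB -EFinM ltry.
Qed.

(** Boundedness matters here: the supremum of an unbounded set is 0 by
    convention. *)
Lemma le_diam (A : set (pt R)) (r : R) (x y : pt R) :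
  (forall z, A z -> `|z.1| <= r /\ `|z.2| <= r) ->
  A x -> A y -> enorm (x - y) <= diam A.
Proof.
move=> rb Ax Ay; apply: ub_le_sup; last by exists x, y.
exists (Num.sqrt ((r + r) ^+ 2 + (r + r) ^+ 2)).
move=> _ [z] [w] [/rb [z1 z2] /rb [w1 w2] ->].
have le2 (s t : R) : `|s| <= r -> `|t| <= r -> (s - t) * (s - t) <= (r + r) ^+ 2.
  move=> hs ht; rewrite -expr2 -real_normK ?num_real//.
  have h : `|s - t| <= r + r by rewrite (le_trans (ler_normB _ _))// lerD.
  by rewrite lerXn2r ?nnegrE// (le_trans _ h).
by rewrite /enorm ler_wsqrtr// /dot lerD//; apply: le2.
Qed.

(** The end points of the first edge are two distinct points of the cell. *)
Lemma diam_closed_cell_gt0 c : Defs.nondegenerate c -> 0 < diam (closed_cell c).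
Proof.
move=> nd; have [r rb] := closed_cell_bounded nd.
suff [x [y [cx cy xy]]] : exists x y, [/\ closed_cell c x, closed_cell c y
    & 0 < dot (x - y) (x - y)].
  by apply: lt_le_trans (le_diam rb cx cy); rewrite /enorm sqrtr_gt0.
(* a nonzero determinant has a nonzero first row *)
have sq0 (s t u v : R) : 0 < s * t - u * v -> 0 < s * s + u * u.
  move=> h; rewrite lt0r addr_ge0 -?expr2 ?sqr_ge0// andbT.
  rewrite paddr_eq0 ?sqr_ge0// !sqrf_eq0; apply: contraTN h => /andP[/eqP-> /eqP->].
  by rewrite !mul0r subr0 ltxx.
case: c nd {rb} => [[a1 a2] [b1 b2] [d1 d2]|[p1 p2] [a1 a2] [b1 b2]];
  rewrite /= /cross /= => D0.
- exists (b1, b2), (a1, a2); split; last exact: sq0 D0.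
  + by apply/closed_cell_tri; rewrite /cross /=; split; lra.
  + by apply/closed_cell_tri; rewrite /cross /=; split; lra.
- exists (p1 + a1, p2 + a2), (p1, p2); split.
  + by apply/closed_cell_para; rewrite /cross /=; split; lra.
  + by apply/closed_cell_para; rewrite /cross /=; split; lra.
  + rewrite /dot /= !(addrC p1) !(addrC p2) !addrK; exact: sq0 D0.
Qed.

Lemma edges_fst c (v : pt R) : v \in vertices c ->
  exists2 e, e \in edges c & e.1 = v.
Proof.
move=> vc; exists (v, nth v (rot 1 (vertices c)) (index v (vertices c))) => //.
have hi : (index v (vertices c) < size (vertices c))%N by rewrite index_mem.
rewrite /edges -{1}(nth_index v vc) -nth_zip ?size_rot//.
by rewrite mem_nth// size_zip size_rot minnn.
Qed.

(** A vertex begins an edge, so the strict inequality attached to that edge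
    reads [0 < 0] there. *)
Lemma vertex_notin_open_cell c v : v \in vertices c -> ~ open_cell c v.
Proof.
move=> /edges_fst [e /[swap] <- ec] /(_ _ ec).
by rewrite subrr /cross /= !mulr0 subrr ltxx.
Qed.

Lemma edge_notin_open_cell c e x : e \in edges c -> segment e x ->
  ~ open_cell c x.
Proof.
move=> ec [t _ <-] /(_ _ ec); rewrite lt0r => /andP[/negP h _]; apply: h.
by apply/eqP; rewrite /cross /edge_pt /=; ring.
Qed.

End CellGeometry.

(** * Cell averages on a conforming mesh *)

Section MeshGeometry.
Context {R : realType} {M : mesh R}.

(** Two distinct cells of a conforming mesh meet at most in a vertex or an
    edge, and neither reaches into an open cell. *)
Lemma open_cell_disjoint (K K' : M) x : open_cell (geo K) x ->
  open_cell (geo K') x -> K = K'.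
Proof.
move=> xK xK'; apply/eqP; apply/negPn/negP => KK'.
have xI : (closed_cell (geo K) `&` closed_cell (geo K')) x.
  by split; exact: open_cell_subset_closed.
case: (geo_conforming KK') => [I0|[v [vK _ I1]]|[e [eK _ Ie]]].
- by rewrite I0 in xI.
- by rewrite I1 in xI; rewrite xI in xK; exact: vertex_notin_open_cell xK.
- by rewrite Ie in xI; exact: edge_notin_open_cell xI xK.
Qed.

Lemma open_cell_Omega (K : M) : open_cell (geo K) `<=` Omega M.
Proof.
rewrite /Omega -open_subsetE; last exact: open_open_cell.
by move=> x /open_cell_subset_closed xK; exists K.
Qed.

Lemma mesh_size_gt0 (K : M) : 0 < mesh_size M.
Proof.
apply: lt_le_trans (le_bigmax _ _ K).
exact/diam_closed_cell_gt0/geo_nondegenerate.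
Qed.

Lemma Qh_funE (q : Qh M) (K : M) x : open_cell (geo K) x -> Qh_fun q x = q K.
Proof.
move=> xK; rewrite /Qh_fun (bigD1 K)//= indicE mem_set// mulr1 big1 ?addr0//.
move=> K' K'K; rewrite indicE memNset ?mulr0// => xK'.
by move/eqP: K'K; apply; exact: open_cell_disjoint xK' xK.
Qed.

Lemma Qh_fun_one_cell (K : M) x :
  Qh_fun (one_cell K) x = \1_(open_cell (geo K)) x.
Proof.
rewrite /Qh_fun (bigD1 K)//= /one_cell eqxx mul1r big1 ?addr0// => K' K'K.
by rewrite (negbTE K'K) mul0r.
Qed.

(** Since the open cell lies in [Omega], both integrands have the same
    extension by zero to the plane, namely [k] times the indicator of the
    cell. *)
Lemma inner_one_cell (f : pt R -> R) (K : M) (k : R) :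
  (forall x, open_cell (geo K) x -> f x = k) ->
  inner M f (Qh_fun (one_cell K)) = k * fine (area (open_cell (geo K))).
Proof.
move=> fk; transitivity
  (Rintegral (@area R) (open_cell (geo K)) (fun=> k)); last first.
  by apply: Rintegral_cst; exact: measurable_open_cell.
rewrite /inner Rintegral_mkcond [RHS]Rintegral_mkcond.
congr (Rintegral _ _ _); apply/funext => x; rewrite /patch.
have [xK|xK] := boolP (x \in open_cell (geo K)); last first.
  by rewrite Qh_fun_one_cell indicE (negbTE xK) mulr0; case: ifP.
rewrite mem_set; last by apply: open_cell_Omega; exact: set_mem xK.
by rewrite Qh_fun_one_cell indicE xK mulr1 fk//; exact: set_mem.
Qed.

End MeshGeometry.

(** * Normal traces and numerical fluxes *)

Section NumericalFlux.
Context {R : realType}.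

(** On a triangle the field is [a + b x] and [x . n] is constant on a line; on
    a parallelogram, moving along an edge changes only the component of the
    field along that edge, which the normal annihilates. *)
Lemma RT0_normal_trace_cst (c : cell R) (v : pt R -> pt R) (e : edge R) t :
  RT0 c v -> e \in edges c ->
  dot (v (edge_pt e t)) (normal e) = dot (v e.1) (normal e).
Proof.
case: c => [a b d|p a b] /=.
  move=> [k [m vE]] _; rewrite !vE /dot /normal /edge_pt /=; ring.
move=> [a0 [a1 [b0 [b1 vE]]]].
pose w s r := pscale (a0 + a1 * s) a + pscale (b0 + b1 * r) b.
have vE' x s r : x.1 = p.1 + s * a.1 + r * b.1 ->
    x.2 = p.2 + s * a.2 + r * b.2 -> v x = w s r.
  by move=> h1 h2; rewrite /w -vE [x]surjective_pairing h1 h2.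
rewrite /edges /= !inE => /or4P[] /eqP -> /=.
- rewrite (vE' _ t 0); try by rewrite /=; ring.
  rewrite (vE' p 0 0); try by rewrite /=; ring.
  by rewrite /dot /normal /w /=; ring.
- rewrite (vE' _ 1 t); try by rewrite /=; ring.
  rewrite (vE' (p + a) 1 0); try by rewrite /=; ring.
  by rewrite /dot /normal /w /=; ring.
- rewrite (vE' _ (1 - t) 1); try by rewrite /=; ring.
  rewrite (vE' (p + a + b) 1 1); try by rewrite /=; ring.
  by rewrite /dot /normal /w /=; ring.
- rewrite (vE' _ 0 (1 - t)); try by rewrite /=; ring.
  rewrite (vE' (p + b) 0 1); try by rewrite /=; ring.
  by rewrite /dot /normal /w /=; ring.
Qed.

Lemma edge_int_cst (e : edge R) (g : pt R -> R) (k : R) :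
  (forall t, g (edge_pt e t) = k) -> edge_int e g = edge_len e * k.
Proof.
move=> gk; rewrite /edge_int (_ : (fun t => _) = fun=> k); last exact/funext.
have mu01 : fine (lebesgue_measure (`[0, 1]%classic : set R)) = 1.
  by rewrite lebesgue_measure_itv /= lte_fin ltr01 oppr0 adde0.
congr (_ * _); rewrite -[RHS]mulr1 -[X in _ = _ * X]mu01.
by apply: Rintegral_cst; exact: measurable_itv.
Qed.

Lemma edge_int_RT0 (c : cell R) (v : pt R -> pt R) (e : edge R) (k k' : R) :
  RT0 c v -> e \in edges c ->
  edge_int e (fun x => k * dot (v x) (normal e) * k')
  = k * k' * (edge_len e * dot (v e.1) (normal e)).
Proof.
move=> vRT ec; rewrite (@edge_int_cst _ _ (k * dot (v e.1) (normal e) * k')).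
  by ring.
by move=> t; rewrite (RT0_normal_trace_cst _ vRT ec).
Qed.

Context {M : mesh R}.

(** The trace at the start of an edge stands for the whole trace, which is
    constant along the edge when [v] is a Raviart--Thomas field. *)
Definition total_flux (v : field M) : R :=
  \sum_(K : M) \sum_(e <- edges (geo K))
    `|edge_len e * dot (v K e.1) (normal e)|.

Lemma total_flux_ge0 (v : field M) : 0 <= total_flux v.
Proof. by apply: sumr_ge0 => K _; apply: sumr_ge0. Qed.

(** The upwind choices and the saturations enter a numerical flux only through
    one scalar coefficient per edge, so a uniform bound on these coefficients
    bounds the flux independently of the saturation. *)
Lemma normr_flux_le (v : field M) (K0 : M) (coef : M -> edge R -> R) (B : R) :
  broken_RT0 v -> (forall K e, `|coef K e| <= B) ->
  `| \sum_(K : M) \sum_(e <- edges (geo K))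
      edge_int e (fun x =>
        coef K e * dot (v K x) (normal e) * one_cell K0 K) |
  <= B * total_flux v.
Proof.
move=> vRT cB; rewrite /total_flux mulr_sumr.
apply: le_trans (ler_norm_sum _ _ _) _; apply: ler_sum => K _.
rewrite mulr_sumr; apply: le_trans (ler_norm_sum _ _ _) _.
rewrite big_seq [leRHS]big_seq; apply: ler_sum => e eK.
rewrite (edge_int_RT0 _ _ (vRT K) eK) normrM ler_wpM2r// normrM /one_cell.
apply: le_trans (cB K e); rewrite ler_piMr//.
by case: eqP => _; rewrite ?normr1 ?normr0.
Qed.

Context {kr : phase -> R -> R} {visc : phase -> R} {l : phase -> R}.
Context (hmob : forall s : R, 0 <= s <= 1 -> 0 < total_mobility kr visc s).
Context (hl : forall a, 0 < l a) (hfrac : frac_bound kr visc l).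

(** The upper bound on one fractional flow gives a lower bound on the other,
    since the two add up to 1. *)
Lemma normr_frac_le a s : 0 <= s <= 1 ->
  `|Defs.frac kr visc a s| <= 1 + l wetting + l nonwetting.
Proof.
move=> s01; have [s0 s1] := andP s01.
have fw : Defs.frac kr visc wetting s <= l wetting.
  by apply: le_trans (hfrac wetting s01) _; rewrite ler_piMr// ltW.
have fn : Defs.frac kr visc nonwetting s <= l nonwetting.
  have s01' : 0 <= 1 - s <= 1 by rewrite subr_ge0 s1 lerBlDr lerDl s0.
  have := hfrac nonwetting s01'; rewrite /= subKr => /le_trans; apply.
  by rewrite ler_piMr ?(ltW (hl _))//; lra.
have sum1 : Defs.frac kr visc wetting s + Defs.frac kr visc nonwetting s = 1.
  by rewrite /frac -mulrDl divff// gt_eqF// hmob.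
have := hl wetting; have := hl nonwetting.
by case: a; rewrite ler_norml; lra.
Qed.

Context {u : phase -> field M}.

(** An upwind wetting saturation is the saturation of some cell, because
    [sat_of] is an involution. *)
Lemma upwind_w_01 a (Sw : Qh M) (K : M) e :
  (forall a K, 0 < sat a Sw K < 1) -> 0 <= upwind_w u a Sw K e <= 1.
Proof.
move=> S01; have {}S01 K' : 0 <= Sw K' <= 1.
  by have := S01 wetting K'; rewrite /sat /= => /andP[/ltW-> /ltW->].
have inv K' : sat_of a (sat a Sw K') = Sw K'.
  by rewrite /sat; case: a => //=; rewrite subKr.
rewrite /upwind_w /upwind; case: ifP => _; first by rewrite inv.
by case: neighbour => [K'|]; rewrite inv.
Qed.

Lemma normr_beta_le a (v : field M) (K : M) (Sw : Qh M) :
  broken_RT0 v -> (forall a K, 0 < sat a Sw K < 1) ->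
  `|beta kr visc u a v (one_cell K) Sw|
  <= (1 + l wetting + l nonwetting) * total_flux v.
Proof.
move=> vRT S01; apply: normr_flux_le => // K' e.
by apply: normr_frac_le; exact: upwind_w_01.
Qed.

Lemma normr_beta_c_le (v : field M) (K : M) (Sw : Qh M) :
  broken_RT0 v -> (forall a K, 0 < sat a Sw K < 1) ->
  `|beta_c kr visc u v (one_cell K) Sw|
  <= (1 + l wetting + l nonwetting) ^+ 2 * total_flux v.
Proof.
move=> vRT S01; apply: (@normr_flux_le _ _ (fun K e =>
  Defs.frac kr visc nonwetting (upwind_w u nonwetting Sw K e)
  * Defs.frac kr visc wetting (upwind_w u wetting Sw K e))) => // K' e.
by rewrite normrM expr2 ler_pM// normr_frac_le//; exact: upwind_w_01.
Qed.

End NumericalFlux.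

(** * Bound preservation *)

Theorem theorem4p1 (R : realType)
  (phi : R) (hphi : 0 < phi < 1)
  (kr : phase -> R -> R) (visc : phase -> R)
  (hvisc : forall a, 0 < visc a)
  (hmob : forall s : R, 0 <= s <= 1 -> 0 < total_mobility kr visc s)
  (l : phase -> R) (hl : forall a, 0 < l a) (hfrac : frac_bound kr visc l)
  (l1 l2 : R) (hl1 : 0 < l1) (hl2 : 0 < l2)
  (M : mesh R)
  (F : phase -> pt R -> R) (hF : forall a, L2 M (F a))
  (u : phase -> field M) (hu : forall a, broken_RT0 (u a))
  (ut xic : field M) (hut : Vh ut) (hxic : Vh xic)
  (St : phase -> R) (hSt : forall a, 0 < St a) :
  exists delta : R, 0 < delta /\
    forall (tn tn1 : R) (Sw Sw1 : Qh M),
      sink_bound F l1 l2 Sw ->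
      total_mass_conservation kr visc u F ut Sw ->
      (forall a K, 0 < sat a Sw K < 1) ->
      (forall a K, St a <= sat a Sw K) ->
      tn < tn1 ->
      (tn1 - tn) / mesh_size M < delta ->
      saturation_update kr visc u F phi (tn1 - tn) ut xic Sw Sw1 ->
      forall a K, 0 < sat a Sw1 K < 1.
Proof.
have phi0 : 0 < phi by case/andP: hphi.
pose B := 1 + l wetting + l nonwetting.
have B0 : 0 <= B by rewrite /B addr_ge0 ?ltW// ltr_wpDr// ltW.
pose vol (K : M) := phi * fine (area (open_cell (geo K))).
have vol0 K : 0 < vol K.
  have nd := geo_nondegenerate K.
  by rewrite mulr_gt0// fine_gt0// area_open_cell_gt0//= area_open_cell_lty.
(* a bound for the rate of change of the saturation in the cell [K] *)
pose rate (K : M) := (B * total_flux ut + B ^+ 2 * total_flux xic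
  + `|inner M (F wetting) (Qh_fun (one_cell K))|) / vol K.
have rate0 K : 0 <= rate K.
  rewrite divr_ge0 ?(ltW (vol0 K))// addr_ge0// addr_ge0 ?mulr_ge0//;
    by rewrite ?total_flux_ge0// exprn_ge0.
pose C := 1 + \sum_K rate K.
have C0 : 0 < C by rewrite /C ltr_wpDr// sumr_ge0.
pose m := Num.min (St wetting) (St nonwetting).
have m0 : 0 < m by rewrite lt_min !hSt.
have h0 : 0 <= mesh_size M.
  by rewrite /mesh_size; elim/big_ind: _ => [//|x y x0 _|K _];
    [rewrite le_max x0|exact/ltW/diam_closed_cell_gt0/geo_nondegenerate].
(* a threshold m / (C * h) would vanish on an empty mesh, where h = 0 and
   division by 0 gives 0; hence the factor 1 + h instead of h *)
exists (m / (C * (1 + mesh_size M))); split.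
  by rewrite divr_gt0// mulr_gt0// ltr_wpDr.
move=> tn tn1 Sw Sw1 _ _ S01 SSt tn01 small upd.
have dt0 : 0 < tn1 - tn by rewrite subr_gt0.
set dt := tn1 - tn in dt0 small upd.
(* an increment below both tolerances cannot make either phase vanish, and
   one saturation stays below 1 when the other stays positive *)
suff incr K : `|Sw1 K - Sw K| < m.
  move=> a K; have := incr K; rewrite lt_min => /andP[].
  have := SSt wetting K; have := SSt nonwetting K.
  by rewrite /sat /=; case: a => /=; rewrite !ltr_norml; lra.
have h1 : 0 < mesh_size M := mesh_size_gt0 K.
have dtC : dt * C < m.
  move: small; rewrite ltr_pdivrMr// -(ltr_pM2r C0) => /lt_le_trans; apply.
  have -> : m / (C * (1 + mesh_size M)) * mesh_size M * C
      = m * (mesh_size M / (1 + mesh_size M)).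
    by field; rewrite (gt_eqF C0) gt_eqF// ltr_wpDr.
  by rewrite ler_piMr ?(ltW m0)// ler_pdivrMr ?ltr_wpDr// mul1r lerDr.
(* testing with the indicator of K turns the scheme into a scalar equation *)
have updK := upd K.
rewrite (@inner_one_cell _ _ _ _ (phi * ((Sw1 K - Sw K) / dt))) in updK; last first.
  by move=> x xK; rewrite !(Qh_funE _ xK).
have : `|Sw1 K - Sw K| <= dt * rate K.
  have -> : Sw1 K - Sw K = dt * ((- beta kr visc u wetting ut (one_cell K) Sw
      + beta_c kr visc u xic (one_cell K) Sw
      + inner M (F wetting) (Qh_fun (one_cell K))) / vol K).
    rewrite -updK /vol; field.
    have := vol0 K; rewrite /vol => /lt0r_neq0; rewrite mulf_eq0 negb_or.
    by move=> /andP[-> ->]; rewrite (gt_eqF dt0).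
  rewrite normrM (gtr0_norm dt0) ler_pM2l// normrM normfV (gtr0_norm (vol0 K)).
  rewrite ler_pM2r ?invr_gt0//.
  apply: le_trans (ler_normD _ _) _; rewrite lerD2r.
  apply: le_trans (ler_normD _ _) _; rewrite normrN.
  apply: lerD; first exact: (normr_beta_le hmob hl hfrac _ _ hut.1 S01).
  exact: (normr_beta_c_le hmob hl hfrac _ hxic.1 S01).
move=> /le_lt_trans; apply; apply: le_lt_trans dtC; rewrite ler_pM2l//.
by rewrite /C (bigD1 K)//= addrCA ler_wpDr// addr_ge0// sumr_ge0.
Qed.
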